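(* Let $(\Gamma,a)$ be a connected weighted graph satisfying $(V_\alpha)$ and $(E_\beta)$ for some $\alpha>\beta\ge2$, and the elliptic Harnack inequality $\mathbf H(C)$. Then for all finite subsets $A\subset\Gamma$ and all $y\in A$, the limit $\lim_{D(x,A)\to\infty}\overline H_A(x,y)$ exists.
   Context: A weighted graph $(\Gamma,a)$ is a countably infinite set $\Gamma$ with a symmetric function $a:\Gamma\times\Gamma\to[0,\infty)$ such that $\pi(x):=\sum_{y\in\Gamma}a(x,y)>0$ for all $x$. Write $x\sim y$ if $a(x,y)>0$; $(\Gamma,\sim)$ is always assumed to be an infinite, locally finite graph without multiple edges. $D$ is the graph distance, $D(x,A)=\inf_{y\in A}D(x,y)$, $B(x,R)=\{y:D(x,y)<R\}$. The random walk $(X_k)_{k\ge0}$ is the Markov chain with transition probabilities $p(x,y)=a(x,y)/\pi(x)$; $P_x,E_x$ are its law and expectation started at $x$. $\tau_A=\inf\{k\ge1:X_k\in A\}$ and, when $P_x(\tau_A<\infty)>0$, $\overline H_A(x,y)=P_x(X_{\tau_A}=y\mid\tau_A<\infty)$ for $y\in A$. Volume: $V(x,R)=\sum_{y\in B(x,R)}\pi(y)$. Mean exit time: $E(x,R)=E_x(\sigma_R)$ with $\sigma_R=\inf\{k\ge0:X_k\notin B(x,R)\}$. $(V_\alpha)$: there is $c\ge1$ such that $c^{-1}R^\alpha\le V(x,R)\le cR^\alpha$ for all $x\in\Gamma$, $R\ge1$. $(E_\beta)$: there is $c\ge1$ such that $c^{-1}R^\beta\le E(x,R)\le cR^\beta$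 for all $x\in\Gamma$, $R\ge1$. For $A\subset\Gamma$, $\partial A=\{y\notin A:\exists x\in A,\ x\sim y\}$, $\overline A=A\cup\partial A$; $u:\overline A\to\mathbb R$ is harmonic in $A$ if $\sum_{y\sim x}p(x,y)(u(y)-u(x))=0$ for all $x\in A$. $\mathbf H(C)$, with shrinking parameter $M>1$: there is a constant $C<\infty$ such that for all $x\in\Gamma$ and $R>0$, and for any positive harmonic function $u$ on $B(x,MR)$, $\max_{B(x,R)}u\le C\min_{B(x,R)}u$. *)

(* Defs.v *)
From HB Require Import structures.
From mathcomp Require Import all_boot all_order all_algebra.
From mathcomp Require Import all_classical all_reals all_analysis.
Import Order.TTheory GRing.Theory Num.Theory.
Import numFieldNormedType.Exports.

Set Implicit Arguments.
Unset Strict Implicit.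
Unset Printing Implicit Defensive.

Local Open Scope classical_set_scope.
Local Open Scope ring_scope.

Definition adj (R : realType) (G : countType) (a : G -> G -> R) : rel G :=
  fun x y => 0 < a x y.

(* [\sum_(y \in A) f y] is a sum over the finite support of [f] in [A] (and 0
   when that support is infinite); in a locally finite graph the supports below
   are all finite. *)
Definition vweight (R : realType) (G : countType) (a : G -> G -> R) (x : G) : R :=
  \sum_(y \in [set: G]) a x y.

(* Loops [0 < a x x] are allowed. *)
Record weighted_graph (R : realType) (G : countType) (a : G -> G -> R) : Prop := {
  wg_infinite : infinite_set [set: G];
  wg_nonneg : forall x y, 0 <= a x y;
  wg_sym : forall x y, a x y = a y x;
  wg_locally_finite : forall x, finite_set [set y | adj a x y];
  wg_weight_gt0 : forall x, 0 < vweight a x }.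

Definition walk (R : realType) (G : countType) (a : G -> G -> R)
    (x y : G) (n : nat) : Prop :=
  exists s : seq G, [/\ path (adj a) x s, last x s = y & size s = n].

Definition connected_graph (R : realType) (G : countType) (a : G -> G -> R) : Prop :=
  forall x y, exists n, walk a x y n.

Definition gdist (R : realType) (G : countType) (a : G -> G -> R) (x y : G) : \bar R :=
  ereal_inf [set (n%:R)%:E | n in [set n : nat | walk a x y n]].

Definition gdist_set (R : realType) (G : countType) (a : G -> G -> R)
    (x : G) (A : set G) : \bar R :=
  ereal_inf [set gdist a x y | y in A].

Definition gball (R : realType) (G : countType) (a : G -> G -> R) (x : G) (r : R) :
    set G :=
  [set y | (gdist a x y < r%:E)%E].

Definition trans (R : realType) (G : countType) (a : G -> G -> R) (x y : G) : R :=
  a x y / vweight a x.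

Definition volume (R : realType) (G : countType) (a : G -> G -> R) (x : G) (r : R) : R :=
  \sum_(y \in gball a x r) vweight a y.

Definition volume_growth (R : realType) (G : countType) (a : G -> G -> R)
    (alpha : R) : Prop :=
  exists2 c : R, 1 <= c & forall (x : G) (r : R), 1 <= r ->
    c^-1 * r `^ alpha <= volume a x r <= c * r `^ alpha.

(* [X] is a process on [Omega] and [P x] its law [P_x]; [G] carries the discrete
   sigma-algebra.  The Markov property is written without dividing by the
   (possibly zero) probability of the past [X_0 = s 0, ..., X_n = s n]. *)
Record random_walk (R : realType) (G : countType) (a : G -> G -> R)
    (d : measure_display) (Omega : measurableType d)
    (X : nat -> Omega -> G) (P : G -> probability Omega R) : Prop := {
  rw_measurable : forall k (B : set G), measurable (X k @^-1` B);
  rw_start : forall x, P x [set w | X 0%N w = x] = 1%E;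
  rw_markov : forall (x : G) (n : nat) (s : nat -> G) (y : G),
    let past := [set w | forall k, (k <= n)%N -> X k w = s k] in
    P x (past `&` [set w | X n.+1 w = y]) = (P x past * (trans a (s n) y)%:E)%E }.

Definition exit_time (R : realType) (G : countType) (a : G -> G -> R)
    (Omega : Type) (X : nat -> Omega -> G) (x : G) (r : R) (w : Omega) : \bar R :=
  ereal_inf [set (k%:R)%:E | k in [set k : nat | ~ gball a x r (X k w)]].

Definition mean_exit_time (R : realType) (G : countType) (a : G -> G -> R)
    (d : measure_display) (Omega : measurableType d)
    (X : nat -> Omega -> G) (P : G -> probability Omega R) (x : G) (r : R) : \bar R :=
  (\int[P x]_w exit_time a X x r w)%E.

Definition exit_time_growth (R : realType) (G : countType) (a : G -> G -> R)
    (d : measure_display) (Omega : measurableType d)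
    (X : nat -> Omega -> G) (P : G -> probability Omega R) (beta : R) : Prop :=
  exists2 c : R, 1 <= c & forall (x : G) (r : R), 1 <= r ->
    ((c^-1 * r `^ beta)%:E <= mean_exit_time a X P x r <= (c * r `^ beta)%:E)%E.

Definition hitting_time (R : realType) (G : countType)
    (Omega : Type) (X : nat -> Omega -> G) (A : set G) (w : Omega) : \bar R :=
  ereal_inf [set (k%:R)%:E | k in [set k : nat | (1 <= k)%N /\ A (X k w)]].

Definition hits (R : realType) (G : countType)
    (Omega : Type) (X : nat -> Omega -> G) (A : set G) : set Omega :=
  [set w | (hitting_time R X A w < +oo)%E].

(* [X_{tau_A} = y], for a finite value of [tau_A]. *)
Definition hits_at (R : realType) (G : countType)
    (Omega : Type) (X : nat -> Omega -> G) (A : set G) (y : G) : set Omega :=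
  [set w | exists2 k : nat, hitting_time R X A w = (k%:R)%:E & X k w = y].

(* The junk value 0 when [P B = 0] does not occur for [hits] of a nonempty set
   in a connected graph. *)
Definition cond_prob (R : realType) (d : measure_display) (Omega : measurableType d)
    (P : probability Omega R) (E B : set Omega) : R :=
  fine (P (E `&` B)) / fine (P B).

Definition hitting_distribution (R : realType) (G : countType)
    (d : measure_display) (Omega : measurableType d)
    (X : nat -> Omega -> G) (P : G -> probability Omega R)
    (A : set G) (x y : G) : R :=
  cond_prob (P x) (hits_at R X A y) (hits R X A).

Definition vboundary (R : realType) (G : countType) (a : G -> G -> R) (A : set G) :
    set G :=
  [set y | ~ A y /\ exists2 x, A x & adj a x y].

Definition vclosure (R : realType) (G : countType) (a : G -> G -> R) (A : set G) :
    set G :=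
  A `|` vboundary a A.

(* Only the values of [u] on [vclosure a A] matter. *)
Definition harmonic_in (R : realType) (G : countType) (a : G -> G -> R)
    (A : set G) (u : G -> R) : Prop :=
  forall x, A x -> \sum_(y \in [set y | adj a x y]) trans a x y * (u y - u x) = 0.

(* Balls are finite and nonempty, so [sup] and [inf] are a maximum and a minimum. *)
Definition elliptic_harnack (R : realType) (G : countType) (a : G -> G -> R)
    (M C : R) : Prop :=
  forall (x : G) (r : R), 0 < r -> forall u : G -> R,
    (forall z, vclosure a (gball a x (M * r)) z -> 0 < u z) ->
    harmonic_in a (gball a x (M * r)) u ->
    sup (u @` gball a x r) <= C * inf (u @` gball a x r).

(* The filter "[D(x, A) tends to infinity]" on vertices [x]. *)
Definition far_from (R : realType) (G : countType) (a : G -> G -> R) (A : set G) :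
    set_system G :=
  filter_from [set: R] (fun N => [set x | (N%:E < gdist_set a x A)%E]).

(* Main.v *)
(** Write g(x,z) for the expected number of visits to z from x, and g_B for
    the walk killed when it leaves B.

    Transience.  Let w lie just outside B(x0,r) and let u = g_{B(x0,3r)}(.,x0).
    As u is harmonic on B(w,r), the Harnack inequality on B(w,r/M) together
    with the volume lower bound, reversibility and the exit time upper bound
    gives u(w) <= K r^(beta-alpha).  Passing from B(x0,r) to B(x0,3r) thus
    raises g by at most K r^(beta-alpha), and these increments are summable
    because beta < alpha.

    Limit.  The Harnack inequality makes the oscillation of g(.,x) on a fixed
    ball decay geometrically in log D(x,A), so g(z,x)/g(y,x) --> 1.  The
    hitting probability h_y of A at y is g_{A^c}(.,y); it is the potential
    sum_(z in A) g(x,z) phi_y(z) of the charge phi_y = h_y - P h_y, so by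
    reversibility the hitting distribution tends to
    sum_z pi(z) phi_y(z) / sum_z pi(z) sum_w phi_w(z). *)

Require Import Defs.
From HB Require Import structures.
From mathcomp Require Import all_boot all_order all_algebra.
From mathcomp Require Import finmap.
From mathcomp Require Import all_classical all_reals all_analysis.
From mathcomp Require Import measurable_realfun.
Import Order.TTheory GRing.Theory Num.Theory.
Import numFieldNormedType.Exports.
From mathcomp Require Import zify ring lra.

Set Implicit Arguments.
Unset Strict Implicit.
Unset Printing Implicit Defensive.

Local Open Scope classical_set_scope.
Local Open Scope ring_scope.

(** * Killed walks and Green functions *)

Section Averaging.
Context {R : realType} {G : countType} (a : G -> G -> R).

Definition nbrs (x : G) : {fset G} := fset_set [set y | adj a x y].

(** The Markov operator of the walk: [f] is harmonic at [x] when [avg f x = f x]. *)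
Definition avg (f : G -> R) (x : G) : R :=
  \sum_(w <- nbrs x) trans a x w * f w.

Hypothesis hG : weighted_graph a.

Let hpos x : 0 < vweight a x. Proof. exact: (wg_weight_gt0 hG). Qed.

Lemma mem_nbrs x w : (w \in nbrs x) = (0 < a x w).
Proof.
rewrite in_fset_set; last exact: (wg_locally_finite hG).
by apply/idP/idP; rewrite inE.
Qed.

Lemma not_adj_weight x w : w \notin nbrs x -> a x w = 0.
Proof.
by rewrite mem_nbrs lt_neqAle (wg_nonneg hG) andbT negbK => /eqP.
Qed.

Lemma vweightE x : vweight a x = \sum_(w <- nbrs x) a x w.
Proof.
rewrite /vweight (fsbigE (nbrs x)) //=.
- by apply: eq_bigl => w; rewrite in_setT.
- by move=> w _; exact: not_adj_weight.
Qed.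

Lemma trans_ge0 x w : 0 <= trans a x w.
Proof. by rewrite divr_ge0 ?(wg_nonneg hG)// ltW. Qed.

Lemma vweight_trans x w : vweight a x * trans a x w = a x w.
Proof. by rewrite /trans mulrC divfK// gt_eqF. Qed.

Lemma avg_cst c x : avg (fun=> c) x = c.
Proof.
rewrite /avg -mulr_suml /trans -mulr_suml -vweightE divff ?mul1r//.
by rewrite gt_eqF.
Qed.

Lemma avgD f g x : avg (fun z => f z + g z) x = avg f x + avg g x.
Proof.
by rewrite /avg -big_split; apply: eq_bigr => w _; rewrite mulrDr.
Qed.

Lemma avgZ c f x : avg (fun z => c * f z) x = c * avg f x.
Proof.
by rewrite /avg mulr_sumr; apply: eq_bigr => w _; rewrite mulrCA.
Qed.

Lemma avgB f g x : avg (fun z => f z - g z) x = avg f x - avg g x.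
Proof.
rewrite avgD -[RHS]/(_ + - avg g x) -mulN1r -avgZ.
by congr (_ + _); apply: eq_bigr => w _; rewrite mulN1r.
Qed.

Lemma avg_sum (I : Type) (s : seq I) (f : I -> G -> R) x :
  avg (fun z => \sum_(i <- s) f i z) x = \sum_(i <- s) avg (f i) x.
Proof.
by rewrite /avg exchange_big; apply: eq_bigr => w _; rewrite mulr_sumr.
Qed.

Lemma avg_le f g x : (forall w, 0 < a x w -> f w <= g w) -> avg f x <= avg g x.
Proof.
move=> fg; rewrite /avg !big_seq; apply: ler_sum => w.
by rewrite mem_nbrs => /fg; apply: ler_wpM2l; exact: trans_ge0.
Qed.

Lemma eq_avg f g x : (forall w, 0 < a x w -> f w = g w) -> avg f x = avg g x.
Proof.
by move=> fg; apply/eqP; rewrite eq_le !avg_le// => w /fg ->.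
Qed.

Lemma avg_ge0 f x : (forall w, 0 <= f w) -> 0 <= avg f x.
Proof. by move=> f0; rewrite -[0](avg_cst 0 x) avg_le. Qed.

Lemma avg_abs f x : `|avg f x| <= avg (fun z => `|f z|) x.
Proof.
apply: le_trans (ler_norm_sum _ _ _) _; apply: ler_sum => w _.
by rewrite normrM (ger0_norm (trans_ge0 _ _)).
Qed.

Lemma avg_indic z x : avg (fun w => (w == z)%:R) x = trans a x z.
Proof.
rewrite /avg; have [zx|zx] := boolP (z \in nbrs x).
  rewrite (big_fsetD1 z)//= eqxx mulr1 big_seq big1 ?addr0// => w.
  by rewrite !inE => /andP[/negbTE -> _]; rewrite mulr0.
rewrite big_seq big1 => [|w wx]; first by rewrite /trans not_adj_weight// mul0r.
by case: eqP wx zx => [-> ->//|_ _ _]; rewrite mulr0.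
Qed.

Lemma cvg_avg (f : nat -> G -> R) (g : G -> R) x :
  (forall w, f n w @[n --> \oo] --> g w) ->
  avg (f n) x @[n --> \oo] --> avg g x.
Proof.
move=> fg; apply: cvg_big; first exact: add_continuous.
by move=> w _; apply: cvgM; [exact: cvg_cst|exact: fg].
Qed.

Lemma harmonic_avg (D : set G) u :
  (forall x, D x -> avg u x = u x) -> harmonic_in a D u.
Proof.
move=> h x Dx; rewrite fsbig_finite/=; last exact: (wg_locally_finite hG).
rewrite -[LHS]/(avg (fun w => u w - u x) x) (avgB u (fun=> u x)) avg_cst.
by rewrite h// subrr.
Qed.

(* [killed B n x z] is the probability that the walk from [x] is in [B] at the
   times [0, ..., n-1] and at [z] at time [n].  As [z] need not be in [B], the
   same kernel describes both exits from balls and first hits of [A = ~` B]. *)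
Fixpoint killed (B : set G) (n : nat) (x z : G) : R :=
  if n is n'.+1 then (x \in B)%:R * avg (killed B n' ^~ z) x else (x == z)%:R.

Definition green_part (B : set G) (n : nat) (x z : G) : R :=
  \sum_(k < n) killed B k x z.

(** For [z] in [B] this is the Green function of the walk killed on leaving [B]; for [z] outside [B]
    it is the probability that the walk leaves [B] at [z]. The limit is meaningful once the partial
    sums are bounded. *)
Definition green (B : set G) (x z : G) : R :=
  limn (fun n => green_part B n x z).

Lemma killed_ge0 B n x z : 0 <= killed B n x z.
Proof.
elim: n x => [|n IH] x /=; first exact: ler0n.
by rewrite mulr_ge0 ?ler0n// avg_ge0.
Qed.

(** The recursion splits off the first step. Time reversal, and the Markov property, which extends a
    past at its end, call for splitting off the last one. *)
Lemma killed_last B n x z :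
  killed B n.+1 x z =
  \sum_(w <- nbrs z) killed B n x w * ((w \in B)%:R * trans a w z).
Proof.
elim: n x => [|n IH] x /=.
  rewrite avg_indic; have [xz|xz] := boolP (x \in nbrs z).
    rewrite (big_fsetD1 x)//= eqxx mul1r big_seq big1 ?addr0// => w.
    by rewrite !inE eq_sym => /andP[/negbTE -> _]; rewrite mul0r.
  rewrite big_seq big1 => [|w wz].
    by rewrite /trans (wg_sym hG) not_adj_weight// mul0r mulr0.
  by case: eqP wz xz => [<- ->//|_ _ _]; rewrite mul0r.
rewrite (eq_avg (g := fun w => \sum_(v <- nbrs z)
    killed B n w v * ((v \in B)%:R * trans a v z))); last by move=> w _; exact: IH.
rewrite avg_sum mulr_sumr; apply: eq_bigr => v _.
rewrite -mulrA; congr (_ * _); rewrite [RHS]mulrC -avgZ.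
by apply: eq_avg => w _; rewrite mulrC.
Qed.

Lemma killed_out B n x z : x \notin B -> z \in B -> killed B n x z = 0.
Proof.
case: n => [|n] /=; last by move=> /negbTE ->; rewrite mul0r.
by move=> xB zB; case: eqP xB zB => [-> /negbTE ->|].
Qed.

(** Reversibility: [pi(x) p(x,w) = a x w] is symmetric, and a first step on one side matches a last
    step on the other. Both ends are taken in [B] because [killed] does not constrain its end
    point. *)
Lemma killed_sym B n x z : x \in B -> z \in B ->
  vweight a x * killed B n x z = vweight a z * killed B n z x.
Proof.
elim: n x z => [|n IH] x z xB zB.
  by rewrite /= eq_sym; case: eqP => [->|]; rewrite ?mulr0.
rewrite [in RHS]killed_last /= xB mul1r /avg !mulr_sumr; apply: eq_bigr => w _.
have [wB|wB] := boolP (w \in B).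
  rewrite mulrA vweight_trans mulr1n mul1r [RHS]mulrA -IH//.
  by rewrite [RHS]mulrAC vweight_trans (wg_sym hG).
by rewrite (killed_out (B := B))// !(mulr0, mul0r).
Qed.

Lemma killed_mono B B' n x z : B `<=` B' -> killed B n x z <= killed B' n x z.
Proof.
move=> BB'; elim: n x => [|n IH] x//=.
apply: ler_pM => //; rewrite ?ler0n ?avg_ge0//; first by move=> w; exact: killed_ge0.
- by rewrite ler_nat; have [/set_mem/BB'/mem_set -> | ] := boolP (x \in B).
- by apply: avg_le => w _; exact: IH.
Qed.

Lemma green_part_ge0 B n x z : 0 <= green_part B n x z.
Proof. by apply: sumr_ge0 => k _; exact: killed_ge0. Qed.

Lemma green_partS B n x z :
  green_part B n.+1 x z = (x == z)%:R + (x \in B)%:R * avg (green_part B n ^~ z) x.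
Proof.
rewrite /green_part big_ord_recl /=; congr (_ + _).
by rewrite -mulr_sumr avg_sum.
Qed.

Lemma green_part_nd B x z : nondecreasing_seq (fun n => green_part B n x z).
Proof.
apply/nondecreasing_seqP => n; rewrite /green_part big_ord_recr /=.
by rewrite lerDl killed_ge0.
Qed.

Lemma green_part_mono B B' n x z : B `<=` B' ->
  green_part B n x z <= green_part B' n x z.
Proof. by move=> BB'; apply: ler_sum => k _; exact: killed_mono. Qed.

Lemma green_part_sym B n x z : x \in B -> z \in B ->
  vweight a x * green_part B n x z = vweight a z * green_part B n z x.
Proof.
by move=> xB zB; rewrite !mulr_sumr; apply: eq_bigr => k _; exact: killed_sym.
Qed.

Definition green_bounded (B : set G) (x z : G) :=
  exists K : R, forall n, green_part B n x z <= K.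

Lemma green_part_cvg B x z : green_bounded B x z ->
  green_part B n x z @[n --> \oo] --> green B x z.
Proof.
move=> [K hK]; apply: nondecreasing_is_cvgn; first exact: green_part_nd.
by exists K => _ [n _ <-].
Qed.

Lemma green_part_le B x z n : green_bounded B x z ->
  green_part B n x z <= green B x z.
Proof.
move=> /green_part_cvg h.
exact: (nondecreasing_cvgn_le (green_part_nd B x z) (cvgP _ h)).
Qed.

Lemma green_le B x z K : (forall n, green_part B n x z <= K) -> green B x z <= K.
Proof.
move=> hK; apply: limr_le.
  by apply: cvgP; apply: green_part_cvg; exists K.
by near=> n; exact: hK.
Unshelve. all: by end_near. Qed.

Lemma green_ge0 B x z : green_bounded B x z -> 0 <= green B x z.
Proof. by move=> /(green_part_le 0); apply: le_trans; exact: green_part_ge0. Qed.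

(** The limit of [green_partS]; it makes [green B ^~ z] harmonic at the points of [B] other than
    [z]. *)
Lemma greenE B x z : (forall w, green_bounded B w z) ->
  green B x z = (x == z)%:R + (x \in B)%:R * avg (green B ^~ z) x.
Proof.
move=> hb; have /cvg_lim <- // : green_part B n.+1 x z @[n --> \oo] -->
    (x == z)%:R + (x \in B)%:R * avg (green B ^~ z) x.
  under eq_fun do rewrite green_partS.
  apply: cvgD; first exact: cvg_cst.
  apply: cvgM; first exact: cvg_cst.
  by apply: cvg_avg => w; exact: green_part_cvg.
apply/esym/cvg_lim => //.
by rewrite (cvg_shiftS (fun n => green_part B n x z)); exact: green_part_cvg.
Qed.

Lemma green_sym B x z : x \in B -> z \in B ->
  green_bounded B x z -> green_bounded B z x ->
  vweight a x * green B x z = vweight a z * green B z x.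
Proof.
move=> xB zB bxz bzx.
have h1 : vweight a x * green_part B n x z @[n --> \oo] -->
   vweight a x * green B x z by apply: cvgM; [exact: cvg_cst|exact: green_part_cvg].
have h2 : vweight a z * green_part B n z x @[n --> \oo] -->
   vweight a z * green B z x by apply: cvgM; [exact: cvg_cst|exact: green_part_cvg].
move: h1; under eq_fun do rewrite green_part_sym//.
by move=> h1; rewrite -(cvg_lim _ h1)// -(cvg_lim _ h2).
Qed.

End Averaging.

(** * Walks, balls and the Harnack inequality *)

Section Walks.
Context {R : realType} {G : countType} (a : G -> G -> R).
Hypothesis hG : weighted_graph a.

Lemma walk0 x : walk a x x 0.
Proof. by exists [::]. Qed.

Lemma walk0_eq x y : walk a x y 0 -> x = y.
Proof. by case=> s [_ + /size0nil s0]; rewrite s0. Qed.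

Lemma walk1 x y : 0 < a x y -> walk a x y 1.
Proof. by move=> xy; exists [:: y]; rewrite /= /adj xy. Qed.

Lemma walk_cat x y z m n : walk a x y m -> walk a y z n -> walk a x z (m + n).
Proof.
move=> [s [ps <- <-]] [t [pt <- <-]]; exists (s ++ t).
by rewrite cat_path ps pt last_cat size_cat.
Qed.

Lemma walkS x y n : walk a x y n.+1 -> exists2 w, 0 < a x w & walk a w y n.
Proof.
move=> [[|w s]] [//= /andP[xw pw] <- [<-]].
by exists w => //; exists s.
Qed.

Lemma walk_sym x y n : walk a x y n -> walk a y x n.
Proof.
elim: n x => [|n IH] x; first by move=> /walk0_eq ->; exact: walk0.
move=> /walkS[w xw /IH wy]; rewrite -addn1; apply: walk_cat wy _.
by apply: walk1; rewrite (wg_sym hG).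
Qed.

Lemma gballP x r y : gball a x r y <-> exists2 n, walk a x y n & n%:R < r.
Proof.
split.
  by move=> /ereal_inf_lt[_ [n xy <-]]; rewrite lte_fin; exists n.
move=> [n xy nr]; rewrite /gball/=.
apply: (le_lt_trans (y := n%:R%:E)); last by rewrite lte_fin.
by apply: ereal_inf_lbound; exists n.
Qed.

Lemma gball_sym x r y : gball a x r y -> gball a y r x.
Proof. by move=> /gballP[n /walk_sym h nr]; apply/gballP; exists n. Qed.

Lemma gball_center x r : 0 < r -> gball a x r x.
Proof. by move=> r0; apply/gballP; exists 0%N => //; exact: walk0. Qed.

Lemma gball_trans x y z r s : gball a x r y -> gball a y s z -> gball a x (r + s) z.
Proof.
move=> /gballP[n xy nr] /gballP[m yz ms]; apply/gballP; exists (n + m)%N.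
  exact: walk_cat xy yz.
by rewrite natrD ltrD.
Qed.

Lemma le_gball x r s : r <= s -> gball a x r `<=` gball a x s.
Proof.
by move=> rs y /gballP[n xy nr]; apply/gballP; exists n => //; exact: lt_le_trans rs.
Qed.

Lemma gball_adj x r y z : gball a x r y -> 0 < a y z -> gball a x (r + 1) z.
Proof.
move=> /gballP[n xy nr] /walk1 yz; apply/gballP; exists (n + 1)%N.
  exact: walk_cat xy yz.
by rewrite natrD ltrD2r.
Qed.

Lemma vclosure_gball x r : vclosure a (gball a x r) `<=` gball a x (r + 1).
Proof.
move=> y [|[_ [z xz zy]]]; last exact: gball_adj xz zy.
by apply: le_gball; rewrite lerDl.
Qed.

Lemma killed_walk B n x z : killed a B n x z != 0 -> walk a x z n.
Proof.
elim: n x => [|n IH] x /=.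
  by case: (x =P z) => [-> _|_]; [exact: walk0|rewrite eqxx].
move=> /eqP h; apply: contrapT => nw; apply: h.
rewrite (@eq_avg _ _ a hG _ (fun=> 0)) ?avg_cst ?mulr0// => w xw.
apply/eqP/negPn/negP => /IH wz; apply: nw.
by rewrite -add1n; apply: walk_cat wz; exact: walk1.
Qed.

Lemma killed_gt0 n x z : walk a x z n -> 0 < killed a setT n x z.
Proof.
elim: n x => [|n IH] x /=.
  by move=> /walk0_eq ->; rewrite eqxx.
move=> /walkS[w xw /IH wz]; rewrite in_setT mul1r.
rewrite /avg (big_fsetD1 w) ?mem_nbrs//=.
apply: ltr_pwDl; first by rewrite mulr_gt0// /trans divr_gt0// (wg_weight_gt0 hG).
by apply: sumr_ge0 => v _; rewrite mulr_ge0 ?trans_ge0 ?killed_ge0.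
Qed.

(** A path of length [n] ending at [x0] stays within distance [n] of [x0], so the killing goes
    unnoticed. *)
Lemma killed_gball n x0 r x : n%:R < r ->
  killed a (gball a x0 r) n x x0 = killed a setT n x x0.
Proof.
elim: n x => [//|n IH] x nr.
have [xB|xB] := boolP (x \in gball a x0 r).
  rewrite /= xB in_setT; congr (_ * _); apply: (eq_avg hG) => w _; apply: IH.
  by apply: lt_trans nr; rewrite ltr_nat.
rewrite [LHS]killed_out//; last first.
  by rewrite inE; apply: gball_center; apply: le_lt_trans nr; rewrite ler0n.
apply/esym/eqP/negPn/negP => /killed_walk/walk_sym h; move: xB.
by rewrite notin_setE; apply; apply/gballP; exists n.+1.
Qed.

End Walks.

(** * Finite balls and the Harnack inequality for nonnegative functions *)

Section VolumeHarnack.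
Context {R : realType} {G : countType} (a : G -> G -> R) (alpha M C : R).
Hypotheses (hG : weighted_graph a) (hV : volume_growth a alpha).
Hypotheses (hM : 1 < M) (hH : elliptic_harnack a M C).

(* A sum over an infinite support is 0, which the volume lower bound excludes. *)
Lemma finite_gball x r : finite_set (gball a x r).
Proof.
wlog r1 : r / 1 <= r => [hw|].
  have /sub_finite_set : gball a x r `<=` gball a x (Num.max 1 r).
    by apply: le_gball; rewrite le_max lexx orbT.
  by apply; apply: hw; rewrite le_max lexx.
have [c c1 /(_ x r r1)/andP[h _]] := hV.
apply: contrapT => inf; move: h; rewrite /volume fsbig_dflt.
  rewrite leNgt => /negP; apply; rewrite mulr_gt0// ?powR_gt0 ?invr_gt0//.
  - exact: lt_le_trans c1.
  - exact: lt_le_trans r1.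
move=> fin; apply: inf; apply: sub_finite_set fin => y By; split => //=.
by apply/eqP; rewrite gt_eqF// (wg_weight_gt0 hG).
Qed.

(** The inequality is tested on the constant function 1; [x0] provides a nonempty ball. *)
Lemma harnack_const_ge1 (x0 : G) : 1 <= C.
Proof.
have := hH (x := x0) (ltr01 : (0 : R) < 1) (u := fun=> 1) (fun _ _ => ltr01) .
have -> : (fun=> 1 : R) @` gball a x0 1 = [set 1].
  apply/seteqP; split => [_ [_ _ <-]//|_ ->]; exists x0 => //.
  exact: gball_center.
rewrite sup1 inf1 mulr1; apply; apply: (harmonic_avg hG) => z _.
exact: avg_cst.
Qed.

(* Apply the Harnack inequality to [u + e / C] and let [e] tend to 0. *)
Lemma harnack_ge0 x r u : 0 < r ->
  (forall z, vclosure a (gball a x (M * r)) z -> 0 <= u z) ->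
  (forall z, gball a x (M * r) z -> avg a u z = u z) ->
  forall y z, gball a x r y -> gball a x r z -> u y <= C * u z.
Proof.
move=> r0 u0 hu y z By Bz.
have C0 : 0 < C by apply: lt_le_trans (harnack_const_ge1 x).
apply/ler_addgt0Pr => e e0.
have d0 : 0 < e / C by rewrite divr_gt0.
set v := fun w => u w + e / C.

(* [sup] and [inf] control the values of [v] only if its image is bounded, which follows from the
   finiteness of the ball. *)
have [vl vu] : has_lbound (v @` gball a x r) /\ has_ubound (v @` gball a x r).
  have uK w : gball a x r w -> `|v w| <= \sum_(i <- fset_set (gball a x r)) `|v i|.
    move=> Bw; rewrite (big_fsetD1 w) ?in_fset_set ?inE//=; last exact: finite_gball.
    by rewrite lerDl sumr_ge0.
  split.
    exists (- \sum_(i <- fset_set (gball a x r)) `|v i|) => _ [w /uK + <-].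
    by rewrite ler_norml => /andP[].
  exists (\sum_(i <- fset_set (gball a x r)) `|v i|) => _ [w /uK + <-].
  by apply: le_trans; exact: ler_norm.
have H : sup (v @` gball a x r) <= C * inf (v @` gball a x r).
  apply: hH => //; first by move=> w /u0 uw; rewrite /v ltr_wpDl.
  by apply: (harmonic_avg hG) => w /hu uw; rewrite /v avgD avg_cst// uw.
have vy : v y <= sup (v @` gball a x r) by apply: ub_le_sup => //; exists y.
have vz : inf (v @` gball a x r) <= v z by apply: ge_inf => //; exists z.
have : v y <= C * v z.
  by apply: le_trans vy _; apply: le_trans H _; rewrite ler_pM2l.
rewrite /v mulrDr (mulrC C (_ / _)) divfK ?gt_eqF// => h.
by apply: le_trans h; rewrite lerDl ltW.
Qed.

End VolumeHarnack.

(** * Transience *)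

Section Transience.
Context {R : realType} {G : countType} (a : G -> G -> R).
Context (alpha beta M C : R).
Hypotheses (hG : weighted_graph a) (hconn : connected_graph a).
Hypotheses (halpha : beta < alpha) (hV : volume_growth a alpha).
Hypotheses (hM : 1 < M) (hH : elliptic_harnack a M C).
(** The upper exit time bound stated on the kernel: expected time spent in a finite part of the ball
    before time [n]. [exit_time_ge_sum] supplies it from the law of the walk. *)
Hypothesis hE : exists2 c : R, 0 < c & forall (x : G) (r : R), 1 <= r ->
  forall F : {fset G}, [set` F] `<=` gball a x r -> forall n,
  \sum_(z <- F) green_part a (gball a x r) n x z <= c * r `^ beta.

(** By symmetry the expected visits from [w] to [x] are, up to weights, those from [x] to [w], a
    single term of the exit time sum. *)
Lemma green_ball_bounded x r w : 1 <= r -> green_bounded a (gball a x r) w x.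
Proof.
move=> r1; have [c c0 hc] := hE.
have xB : x \in gball a x r by rewrite inE; exact/gball_center/lt_le_trans/r1.
have [wB|wB] := boolP (w \in gball a x r); last first.
  exists 0 => n; rewrite /green_part big1// => k _; exact: killed_out.
exists (vweight a x * (c * r `^ beta) / vweight a w) => n.
rewrite ler_pdivlMr ?(wg_weight_gt0 hG)// mulrC green_part_sym//.
rewrite ler_pM2l ?(wg_weight_gt0 hG)//.
have := hc x r r1 [fset w]%fset _ n; rewrite big_seq_fset1; apply => z /=.
by rewrite inE => /eqP ->; move: wB; rewrite inE.
Qed.

Lemma green_sum_le B x (F : seq G) K : (forall z, z \in F -> green_bounded a B x z) ->
  (forall n, \sum_(z <- F) green_part a B n x z <= K) ->
  \sum_(z <- F) green a B x z <= K.
Proof.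
move=> hb hK; have h : (\sum_(z <- F) green_part a B n x z) @[n --> \oo] -->
    \sum_(z <- F) green a B x z.
  rewrite big_seq; under eq_fun do rewrite big_seq.
  apply: cvg_big => [|z zF]; first exact: add_continuous.
  exact/green_part_cvg/hb.
rewrite -(cvg_lim _ h)//; apply: limr_le; first exact: cvgP h.
by near=> n; exact: hK.
Unshelve. all: by end_near. Qed.

(** Harnack compares the value at [w] with all values on [B(w, r/M)], whose [pi]-mass is at least of
    order [r^alpha]; reversibility bounds the [pi]-weighted sum of these values by [pi(x0)] times an
    exit time bound of order [r^beta]. *)
Lemma green_sphere_le : exists2 K : R, 0 < K & forall (x0 w : G) (r : R), M <= r ->
  ~ gball a x0 r w -> gball a x0 (r + 1) w ->
  green a (gball a x0 (3 * r)) w x0 <= vweight a x0 * K * r `^ (beta - alpha).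
Proof.
have [c c0 hc] := hE; have [c' c'1 hV'] := hV.
have M0 : 0 < M by apply: lt_trans hM.
have c'0 : 0 < c' by apply: lt_le_trans c'1.
exists (Num.max 1 C * c * c' * 3 `^ beta / (M^-1) `^ alpha).
  by rewrite !(mulr_gt0, invr_gt0, powR_gt0)// lt_max ltr01.
move=> x0 w r Mr wr wr1.
have r0 : 0 < r by apply: lt_le_trans Mr.
have r1 : 1 <= r by apply: le_trans Mr; exact: ltW.
(* The volume lower bound is used at radius [r / M], which explains the condition [M <= r]. *)
have rM1 : 1 <= r / M by rewrite ler_pdivlMr// mul1r.
have r31 : 1 <= 3 * r by lra.
have C1 : 1 <= C := harnack_const_ge1 hG hH x0.
rewrite (max_r C1).
set B := gball a x0 (3 * r).
have bd z : green_bounded a B z x0 by exact: green_ball_bounded.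
(* [B(w, r)] lies in [B(x0, 2 r + 1)], and [1 <= r]: hence the factor 3. *)
have sub : gball a w r `<=` B.
  move=> z wz; have := gball_trans wr1 wz; apply: le_gball; lra.
have sub' : gball a w (r / M) `<=` B.
  apply: subset_trans sub; apply: le_gball.
  by rewrite ler_pdivrMr// ler_pMr// ltW.
have x0B : x0 \in B by rewrite inE; apply: gball_center; lra.
have H z : gball a w (r / M) z -> green a B w x0 <= C * green a B z x0.
  move=> wz; apply: (harnack_ge0 hG hV hH (x := w) (r := r / M)
    (u := green a B ^~ x0)) => //; last by apply: gball_center; lra.
  - lra.
  - by move=> y _; exact: green_ge0.
  - move=> y; rewrite mulrCA divff ?gt_eqF// mulr1 => wy.
    rewrite [RHS]greenE//; have -> : y \in B by rewrite inE; exact: sub.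
    (* Harmonicity could fail only at the pole [x0], but [x0] in [B(w, r)] would put [w] in
       [B(x0, r)]. *)
    rewrite mul1r; case: eqP => [yx|_]; last by rewrite add0r.
    by case: wr; apply: (gball_sym hG); rewrite -yx.
set F := fset_set (gball a w (r / M)).
have inF z : (z \in F) = (z \in gball a w (r / M)).
  by rewrite in_fset_set//; exact: (finite_gball hG hV).
have FB : [set` F] `<=` B by move=> z /=; rewrite inF inE => /sub'.
have bd' z : z \in F -> green_bounded a B x0 z.
  move=> zF; have zB : z \in B by rewrite inE; exact: FB.
  have [K hK] := bd z; exists (vweight a z * K / vweight a x0) => n.
  rewrite ler_pdivlMr ?(wg_weight_gt0 hG)// mulrC green_part_sym//.
  by rewrite ler_pM2l ?(wg_weight_gt0 hG).
have low : c'^-1 * (r / M) `^ alpha <= \sum_(z <- F) vweight a z.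
  have /andP[] := hV' w _ rM1; rewrite /volume fsbig_finite//.
  exact: (finite_gball hG hV).
have up : \sum_(z <- F) vweight a z * green a B z x0 <=
    vweight a x0 * (c * (3 * r) `^ beta).
  have -> : \sum_(z <- F) vweight a z * green a B z x0 =
      vweight a x0 * \sum_(z <- F) green a B x0 z.
    rewrite mulr_sumr !big_seq; apply: eq_bigr => z zF.
    have zB : z \in B by rewrite inE; exact: FB.
    by rewrite green_sym//; exact: bd'.
  rewrite ler_pM2l ?(wg_weight_gt0 hG)//; apply: green_sum_le => // n.
  exact: hc.
(* The Harnack bounds are summed over [F] with weights [pi]. *)
have key : green a B w x0 * (c'^-1 * (r / M) `^ alpha) <=
    C * (vweight a x0 * (c * (3 * r) `^ beta)).
  apply: (@le_trans _ _ (green a B w x0 * \sum_(z <- F) vweight a z)).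
    by rewrite ler_wpM2l// green_ge0.
  apply: (@le_trans _ _ (C * \sum_(z <- F) vweight a z * green a B z x0)).
    rewrite !mulr_sumr !big_seq; apply: ler_sum => z zF.
    rewrite mulrC mulrCA ler_pM2l ?(wg_weight_gt0 hG)//; apply: H.
    by apply/set_mem; rewrite -inF.
  by rewrite ler_pM2l// (lt_le_trans ltr01).
move: key; rewrite -ler_pdivlMr; last first.
  by rewrite mulr_gt0 ?invr_gt0 ?powR_gt0// divr_gt0.
move/le_trans; apply.
have rB : r `^ (beta - alpha) = r `^ beta / r `^ alpha.
  by rewrite powRB// (gt_eqF r0) implybT.
have rM : (r / M) `^ alpha = r `^ alpha * M^-1 `^ alpha.
  by rewrite powRM ?invr_ge0// ltW.
have r3 : (3 * r) `^ beta = 3 `^ beta * r `^ beta by rewrite powRM// ltW.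
rewrite rM r3 rB le_eqVlt; apply/orP; left; apply/eqP.
have [] : r `^ alpha != 0 /\ M^-1 `^ alpha != 0.
  by rewrite !gt_eqF ?powR_gt0 ?invr_gt0.
move: (gt_eqF c'0) => /negbT.
set ra := r `^ alpha; set ma := M^-1 `^ alpha; move=> *.
by field; do ?[apply/andP; split]; assumption.
Qed.

(** First-step induction: inside [B] both walks count the same visits, and from the exit point of
    [B] the larger walk adds at most [m]. *)
Lemma green_part_annulus B B' z m :
  B `<=` B' -> z \in B -> 0 <= m ->
  (forall y w, B y -> ~ B w -> 0 < a y w -> forall n, green_part a B' n w z <= m) ->
  forall n x, x \in B -> green_part a B' n x z <= green_part a B n x z + m.
Proof.
move=> BB' zB m0 hm; elim=> [|n IH] x xB.
  by rewrite /green_part !big_ord0 add0r.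
have xB' : x \in B' by rewrite inE; apply: BB'; rewrite inE in xB.
rewrite !green_partS// xB xB' !mul1r -addrA lerD2l.
rewrite -[m in leRHS](avg_cst hG m x) -avgD; apply: (avg_le hG) => w xw.
have [wB|wB] := boolP (w \in B); first exact: IH.
apply: (@le_trans _ _ m); last by rewrite lerDr green_part_ge0.
by apply: (hm x w) => //; [exact: set_mem|rewrite notin_setE in wB].
Qed.

(** Along balls of radius [3^(j0 + j)] the sphere estimate bounds the successive increments by a
    geometric series of ratio [th = 3^(beta - alpha) < 1]. *)
Lemma green_bounded_full x x0 : green_bounded a setT x x0.
Proof.
have [K K0 hK] := green_sphere_le.
have [d xd] := hconn x0 x.
have M0 : 0 < M by apply: lt_trans hM.
(* Large enough for the first ball to contain [x] and for its radius to be at least [M]. *)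
pose j0 := (Num.bound M + d.+1)%N.
pose ball j := gball a x0 (3 ^+ (j0 + j)).
have le3 k : k%:R <= 3 ^+ k :> R.
  by rewrite -natrX ler_nat; apply: ltnW; exact: ltn_expl.
have j0ge j : j0%:R <= 3 ^+ (j0 + j) :> R.
  by apply: le_trans (le3 _); rewrite ler_nat leq_addr.
have Mj j : M <= 3 ^+ (j0 + j).
  apply: le_trans (j0ge j); rewrite natrD.
  by rewrite ler_wpDr// ltW// archi_boundP// ltW.
have ge1 j : 1 <= 3 ^+ (j0 + j) :> R by apply: le_trans (Mj j); exact: ltW.
have xball j : x \in ball j.
  rewrite inE; apply/gballP; exists d => //.
  by apply: lt_le_trans (j0ge j); rewrite ltr_nat /j0; lia.
have x0ball j : x0 \in ball j.
  by rewrite inE; apply: gball_center; exact: lt_le_trans (ge1 j).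
pose th : R := 3 `^ (beta - alpha).
have th0 : 0 < th by rewrite powR_gt0.
have th1 : th < 1.
  have ab : 0 < alpha - beta by rewrite subr_gt0.
  rewrite /th -opprB powRN invf_lt1 ?powR_gt0//.
  have := @gt0_ltr_powR _ _ ab 1 3; rewrite powR1; apply; rewrite ?nnegrE; lra.
have thE j : (3 ^+ j) `^ (beta - alpha) = th ^+ j.
  by rewrite -powR_mulrn// -powRrM mulrC powRrM powR_mulrn// ltW.
pose L := vweight a x0 * K.
have L0 : 0 <= L by rewrite mulr_ge0 ?ltW// (wg_weight_gt0 hG).
have [K0' hK0] : green_bounded a (ball 0%N) x x0 by exact: green_ball_bounded.
have step j n : green_part a (ball j) n x x0 <= K0' + L * ((1 - th ^+ j) / (1 - th)).
  elim: j n => [|j IH] n; first by rewrite expr0 subrr mul0r mulr0 addr0.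
  have := @green_part_annulus (ball j) (ball j.+1) x0 (L * th ^+ j).
  move=> /(_ _ (x0ball j) _ _ n x (xball j))/le_trans; apply.
  - by apply: le_gball; rewrite ler_eXn2l ?ltr1n// leq_add2l.
  - by rewrite mulr_ge0// exprn_ge0// ltW.
  - move=> y w jy jw yw k.
    apply: le_trans (green_part_le hG k _) _.
      by apply: green_ball_bounded; exact: ge1.
    rewrite /ball addnS exprS.
    apply: le_trans (hK _ _ _ (Mj j) jw (gball_adj jy yw)) _.
    (* The estimate yields [th ^+ (j0 + j)]; the factor [th ^+ j0 <= 1] is dropped. *)
    rewrite ler_wpM2l// thE exprD ler_piMl ?exprn_ge0 ?exprn_ile1// ltW//.
  - apply: le_trans (lerD (IH n) (lexx _)) _.
    rewrite -addrA lerD2l -mulrDr ler_wpM2l// exprS.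
    rewrite le_eqVlt; apply/orP; left; apply/eqP; field.
    by rewrite subr_eq0 gt_eqF.
exists (K0' + L / (1 - th)) => n.
(* The ball may depend on [n], since the bound on its Green function is uniform in the ball. *)
have -> : green_part a setT n x x0 = green_part a (ball n) n x x0.
  apply: eq_bigr => k _; rewrite killed_gball//.
  apply: lt_le_trans (le3 _); rewrite ltr_nat.
  by apply: leq_trans (ltn_ord k) _; rewrite leq_addl.
apply: le_trans (step n n) _; rewrite lerD2l ler_wpM2l//.
rewrite ler_pdivrMr ?subr_gt0// mulVf ?subr_eq0 ?gt_eqF//.
by rewrite gerBl exprn_ge0// ltW.
Qed.

End Transience.

(** * Behaviour of the Green function far from a finite set *)

Section FarFilter.
Context {R : realType} {G : countType} (a : G -> G -> R) (A : set G).

Global Instance far_from_filter : Filter (far_from a A).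
Proof.
apply: filter_from_filter; first by exists 0.
move=> r s _ _; exists (Num.max r s) => // x /= h.
by split; apply: le_lt_trans h; rewrite lee_fin le_max lexx ?orbT.
Qed.

Lemma far_not_gball y r : weighted_graph a -> A y ->
  \forall x \near far_from a A, ~ gball a y r x.
Proof.
move=> hG Ay; exists r => // x /= h /(gball_sym hG) yx.
have : (gdist_set a x A <= gdist a x y)%E by apply: ereal_inf_lbound; exists y.
by move=> /(lt_le_trans h)/lt_trans/(_ yx); rewrite ltxx.
Qed.

End FarFilter.

(** * Decay of the oscillation of harmonic functions and ratios of Green functions *)

Section Oscillation.
Context {R : realType} {G : countType} (a : G -> G -> R).
Context (alpha M C : R).
Hypotheses (hG : weighted_graph a) (hconn : connected_graph a).
Hypotheses (hV : volume_growth a alpha).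
Hypotheses (hM : 1 < M) (hH : elliptic_harnack a M C).

Let theta := 1 - (2 * C)^-1.

(** If [u y] is in the upper half of the range, Harnack for [u - lo] raises the lower bound by
    [(hi - lo) / (2 C)]; otherwise Harnack for [hi - u] lowers the upper bound by as much. *)
Lemma harnack_oscillation_step y r u lo hi : 1 <= r ->
  (forall z, gball a y ((M + 1) * r) z -> avg a u z = u z) ->
  (forall z, gball a y ((M + 1) * r) z -> lo <= u z <= hi) ->
  exists l h, h - l = theta * (hi - lo) /\
    forall z, gball a y r z -> l <= u z <= h.
Proof.
move=> r1 hu hb.
have C1 : 1 <= C := harnack_const_ge1 hG hH y.
have r0 : 0 < r by lra.
have subM : gball a y (M * r) `<=` gball a y ((M + 1) * r).
  by apply: le_gball; rewrite ler_pM2r//; lra.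
(* Harnack asks for a sign on the closure too, which reaches radius [M r + 1]; this is why the outer
   radius is [(M + 1) r] with [1 <= r]. *)
have subc : vclosure a (gball a y (M * r)) `<=` gball a y ((M + 1) * r).
  move=> z /vclosure_gball; apply: le_gball.
  by rewrite mulrDl mul1r lerD2l.
have sub1 : gball a y r `<=` gball a y ((M + 1) * r).
  by apply: le_gball; rewrite ler_peMl ?(ltW r0)// lerDr ltW// (lt_trans _ hM).
have yy : gball a y r y by exact: gball_center.
have C2 : C * (2 * C)^-1 = 2^-1 by field; lra.
have Ci : 0 < (2 * C)^-1 by rewrite invr_gt0; lra.
have [mid|mid] := leP ((lo + hi) / 2) (u y).
- have h z : gball a y r z -> u y - lo <= C * (u z - lo).
    move=> yz; apply: (harnack_ge0 hG hV hH (x := y) (r := r)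
      (u := fun w => u w - lo)) => //.
      by move=> w /subc/hb/andP[]; rewrite subr_ge0.
    by move=> w /subM/hu uw; rewrite avgB avg_cst// uw.
  exists (lo + (2 * C)^-1 * (hi - lo)), hi; split; first by rewrite /theta; lra.
  move=> z yz; have /andP[_ ->] := hb _ (sub1 _ yz); rewrite andbT.
  have {}h := h _ yz.
  rewrite -lerBrDl -(@ler_pM2l _ C) ?mulrA ?C2; lra.
- have h z : gball a y r z -> hi - u y <= C * (hi - u z).
    move=> yz; apply: (harnack_ge0 hG hV hH (x := y) (r := r)
      (u := fun w => hi - u w)) => //.
      by move=> w /subc/hb/andP[_]; rewrite subr_ge0.
    by move=> w /subM/hu uw; rewrite (avgB a (fun=> hi)) avg_cst// uw.
  exists lo, (hi - (2 * C)^-1 * (hi - lo)); split; first by rewrite /theta; lra.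
  move=> z yz; have /andP[-> _] := hb _ (sub1 _ yz) => /=.
  have {}h := h _ yz.
  rewrite lerBrDr -lerBrDl -(@ler_pM2l _ C) ?mulrA ?C2; lra.
Qed.

Lemma harnack_oscillation y u lo hi j r : 1 <= r ->
  (forall z, gball a y ((M + 1) ^+ j * r) z -> avg a u z = u z) ->
  (forall z, gball a y ((M + 1) ^+ j * r) z -> lo <= u z <= hi) ->
  exists l h, h - l = theta ^+ j * (hi - lo) /\
    forall z, gball a y r z -> l <= u z <= h.
Proof.
elim: j r => [|j IH] r r1.
  by rewrite !expr0 !mul1r => _ hb; exists lo, hi.
rewrite !exprSr -!mulrA => hu hb.
have r2 : 1 <= (M + 1) * r.
  by apply: mulr_ege1 => //; rewrite lerDr ltW// (lt_trans _ hM).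
have [l [h [hl hlh]]] := IH _ r2 hu hb.
have hu1 z : gball a y ((M + 1) * r) z -> avg a u z = u z.
  move=> yz; apply: hu; apply: le_gball yz.
  by rewrite ler_peMl ?exprn_ege1 ?(le_trans ler01 r2)// lerDr ltW// (lt_trans _ hM).
have [l' [h' [hl' hlh']]] := harnack_oscillation_step r1 hu1 hlh.
by exists l', h'; split => //; rewrite hl' hl mulrCA.
Qed.

Hypothesis hT : forall x z, green_bounded a setT x z.

Lemma green_gt0 x z : 0 < green a setT x z.
Proof.
have [n /(killed_gt0 hG) h] := hconn x z.
apply: (lt_le_trans h); apply: le_trans (green_part_le hG n.+1 (hT x z)).
rewrite /green_part big_ord_recr /= lerDr; exact: (green_part_ge0 hG setT n).
Qed.

Lemma green_harmonic x z : z <> x ->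
  avg a (green a setT ^~ x) z = green a setT z x.
Proof.
move=> /eqP/negbTE zx.
by rewrite [RHS]greenE// zx add0r in_setT mul1r.
Qed.

(** For [x] far away, [green a setT ^~ x] is harmonic on a large ball around [y]. Harnack confines
    it to [[0, C g(y,x)]] there, and [j] oscillation steps leave a range of length
    [C theta^j g(y,x)] on a ball containing [z]. *)
Lemma green_ratio_far A y z : A y ->
  green a setT z x / green a setT y x @[x --> far_from a A] --> (1 : R).
Proof.
move=> Ay; have C1 : 1 <= C := harnack_const_ge1 hG hH y.
have Ci : 0 < (2 * C)^-1 < 1 by rewrite invr_gt0 invf_lt1; lra.
have [d yz] := hconn y z.
pose r : R := d.+1%:R.
have r1 : 1 <= r by rewrite ler1n.
have zr : gball a y r z by apply/gballP; exists d => //; rewrite ltr_nat.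
apply/cvgrPdist_le => e e0.
have [j hj] : exists j, C * theta ^+ j <= e.
  have h : C * theta ^+ j @[j --> \oo] --> C * 0.
    by apply: cvgM; [exact: cvg_cst|apply: cvg_expr; rewrite ger0_norm /theta; lra].
  move/cvgrPdist_le : h => /(_ e e0)[j _ /(_ j (leqnn j))] /=.
  rewrite mulr0 sub0r normrN ger0_norm; first by exists j.
  by rewrite mulr_ge0 ?exprn_ge0 /theta; lra.
(* The oscillation steps use up [(M + 1) ^+ j * r]; one more factor [M + 1] leaves room for the
   initial Harnack bound on that ball. *)
apply: filterS (far_not_gball ((M + 1) ^+ j.+1 * r) hG Ay) => x xfar.
have uy := green_gt0 y x.
have hu w : gball a y ((M + 1) ^+ j.+1 * r) w ->
    avg a (green a setT ^~ x) w = green a setT w x.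
  by move=> yw; apply: green_harmonic => wx; apply: xfar; rewrite -wx.
have M1 : 1 <= M + 1 by rewrite lerDr ltW// (lt_trans _ hM).
have rj : 0 < (M + 1) ^+ j * r.
  by rewrite mulr_gt0 ?exprn_gt0// (lt_le_trans ltr01).
have hb w : gball a y ((M + 1) ^+ j * r) w ->
    0 <= green a setT w x <= C * green a setT y x.
  move=> yw; rewrite green_ge0//=.
  apply: (harnack_ge0 hG hV hH (x := y) (r := (M + 1) ^+ j * r)
    (u := green a setT ^~ x)) => //; last exact: gball_center.
    by move=> v _; exact: green_ge0.
  move=> v yv; apply: hu; apply: le_gball yv.
  by rewrite exprS -!mulrA ler_pM2r// lerDl.
have hu' w : gball a y ((M + 1) ^+ j * r) w ->
    avg a (green a setT ^~ x) w = green a setT w x.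
  move=> yw; apply: hu; apply: le_gball yw.
  by rewrite exprS -!mulrA ler_peMl// ltW.
have [l [h [hl hlh]]] := harnack_oscillation r1 hu' hb.
have /andP[z1 z2] := hlh _ zr.
have /andP[y1 y2] := hlh y (gball_center a y (lt_le_trans ltr01 r1)).
rewrite -(@ler_pM2r _ (green a setT y x))// -[X in _ * X <= _](gtr0_norm uy).
rewrite -normrM mulrBl mul1r divfK ?gt_eqF//.
apply: (@le_trans _ _ (h - l)); first by rewrite ler_norml; lra.
by rewrite hl subr0 mulrA ler_pM2r// mulrC.
Qed.

End Oscillation.

(** * Hitting probabilities as potentials *)

Section Hitting.
Context {R : realType} {G : countType} (a : G -> G -> R) (A : set G).
Hypotheses (hG : weighted_graph a) (hA : finite_set A).
Hypothesis hT : forall x z, green_bounded a setT x z.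

Let F := fset_set A.

Let inF z : (z \in F) = (z \in A). Proof. exact: in_fset_set. Qed.

(** The charge [phi_y = h_y - P h_y], where [h_y] also counts a hit at time 0: on [A] it is the
    indicator of [y]. It agrees with hitting at times at least 1 for starts outside [A]. *)
Definition charge_at (y z : G) : R :=
  green a (~` A) z y - avg a (green a (~` A) ^~ y) z.

Lemma green_bounded_sub B x z : green_bounded a B x z.
Proof.
have [K hK] := hT x z; exists K => n; apply: le_trans (hK n).
exact: green_part_mono.
Qed.

Lemma green_mono B x z : green a B x z <= green a setT x z.
Proof.
apply: green_le => // n; apply: le_trans (green_part_le hG n (hT x z)).
exact: green_part_mono.
Qed.

Lemma green_hit_on y z : z \in A -> green a (~` A) z y = (z == y)%:R.
Proof.
move=> zA; rewrite greenE//; last by move=> w; exact: green_bounded_sub.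
by rewrite in_setC zA mul0r addr0.
Qed.

(** [h_y] is harmonic off [A], so its charge has finite support. *)
Lemma charge_out y z : y \in A -> z \notin A -> charge_at y z = 0.
Proof.
move=> yA zA; rewrite /charge_at greenE//; last by move=> w; exact: green_bounded_sub.
rewrite in_setC zA mul1r; case: eqP => [zy|_]; last by rewrite add0r subrr.
by rewrite zy yA in zA.
Qed.

(** The difference inside the norm is [P^n h_y], and [h_y <= g(.,y)] bounds it by [P^n g(.,y)], the
    tail of the Green series. *)
Lemma hit_repr_part n x y : y \in A ->
  `|green a (~` A) x y - \sum_(z <- F) green_part a setT n x z * charge_at y z|
  <= green a setT x y - green_part a setT n x y.
Proof.
move=> yA; elim: n x => [|n IH] x.
  rewrite /green_part big_ord0 subr0 big1 => [|z _]; last by rewrite big_ord0 mul0r.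
  by rewrite subr0 ger0_norm ?green_mono// green_ge0//; exact: green_bounded_sub.
(* The time 0 term of the sum is the charge at [x]; subtracting it from [h_y] leaves [P h_y]. *)
have -> : green a (~` A) x y - \sum_(z <- F) green_part a setT n.+1 x z * charge_at y z
  = avg a (fun w => green a (~` A) w y -
      \sum_(z <- F) green_part a setT n w z * charge_at y z) x.
  rewrite avgB avg_sum.
  under eq_bigr do rewrite green_partS// in_setT mul1r mulrDl.
  rewrite big_split /= opprD addrA; congr (_ - _); last first.
    apply: eq_bigr => z _; rewrite mulrC -avgZ.
    by apply: (eq_avg hG) => w _; rewrite mulrC.
  have -> : \sum_(z <- F) (x == z)%:R * charge_at y z = charge_at y x.
    have [xA|xA] := boolP (x \in F).
      rewrite (big_fsetD1 x)//= eqxx mul1r big_seq big1 ?addr0// => w.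
      by rewrite !inE eq_sym => /andP[/negbTE -> _]; rewrite mul0r.
    have xA' : x \notin A by rewrite -inF.
    rewrite (charge_out yA xA') big_seq big1// => w wF.
    by case: eqP wF xA => [-> ->//|_ _ _]; rewrite mul0r.
  by rewrite /charge_at opprB addrC subrK.
apply: (le_trans (avg_abs hG _ _)).
rewrite [green a setT x y]greenE// green_partS// in_setT !mul1r opprD addrACA subrr.
by rewrite add0r -avgB; apply: (avg_le hG) => w _; exact: IH.
Qed.

Lemma hit_repr x y : y \in A ->
  green a (~` A) x y = \sum_(z <- F) green a setT x z * charge_at y z.
Proof.
move=> yA.
have h1 : \sum_(z <- F) green_part a setT n x z * charge_at y z @[n --> \oo] -->
    \sum_(z <- F) green a setT x z * charge_at y z.
  apply: cvg_big => [|z _]; first exact: add_continuous.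
  by apply: cvgM; [exact: green_part_cvg|exact: cvg_cst].
have h0 : green a setT x y - green_part a setT n x y @[n --> \oo] --> (0 : R).
  rewrite -[0](subrr (green a setT x y)).
  by apply: cvgB; [exact: cvg_cst|exact: green_part_cvg].
apply/eqP; rewrite -subr_eq0 -normr_le0.
have h2 : `|green a (~` A) x y - \sum_(z <- F) green_part a setT n x z * charge_at y z|
   @[n --> \oo] --> `|green a (~` A) x y - \sum_(z <- F) green a setT x z * charge_at y z|.
  by apply: cvg_norm; apply: cvgB => //; exact: cvg_cst.
by apply: (ler_cvg_to h2 h0); near=> n; exact: hit_repr_part.
Unshelve. all: by end_near. Qed.

(** First-step induction: on [A] the indicators sum to 1 and the walk stops; elsewhere [avg]
    preserves the bound 1. *)
Lemma hit_total_le1 x : \sum_(y <- F) green a (~` A) x y <= 1.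
Proof.
apply: green_sum_le => // [z _|n]; first exact: green_bounded_sub.
elim: n x => [|n IH] x.
  by rewrite big1// => z _; rewrite /green_part big_ord0.
under eq_bigr do rewrite green_partS//.
have [xA|xA] := boolP (x \in F).
  rewrite big_split /= [X in _ + X]big1 => [|z _]; last first.
    by rewrite in_setC -inF xA mul0r.
  rewrite addr0 (big_fsetD1 x)//= eqxx big_seq big1 ?addr0// => w.
  by rewrite !inE eq_sym => /andP[/negbTE ->].
rewrite big_split /= big_seq big1 => [|w wF]; last first.
  by case: eqP wF xA => [-> ->|].
rewrite add0r -mulr_sumr -avg_sum in_setC -inF xA mul1r.
by rewrite -[leRHS](avg_cst hG 1 x); apply: (avg_le hG) => w _; exact: IH.
Qed.

(** This is the capacity of [A], the denominator of the limit. The total hitting probability is 1 on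
    [A] and at most 1 elsewhere, so the total charge is nonnegative on [A]; if it vanished
    throughout [A], [hit_repr] would make that probability 0 on [A]. *)
Lemma charge_total_gt0 : A !=set0 ->
  0 < \sum_(z <- F) vweight a z * \sum_(y <- F) charge_at y z.
Proof.
move=> [y0 Ay0]; have y0F : y0 \in F by rewrite inF inE.
have on1 z : z \in F -> \sum_(y <- F) green a (~` A) z y = 1.
  move=> zF; under eq_bigr do rewrite green_hit_on -?inF//.
  rewrite (big_fsetD1 z)//= eqxx big_seq big1 ?addr0// => w.
  by rewrite !inE eq_sym => /andP[/negbTE ->].
have ch0 z : z \in F -> 0 <= \sum_(y <- F) charge_at y z.
  move=> zF; rewrite /charge_at sumrB on1// -avg_sum subr_ge0.
  by rewrite -[leRHS](avg_cst hG 1 z); apply: (avg_le hG) => w _; exact: hit_total_le1.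
rewrite lt_neqAle; apply/andP; split; last first.
  by rewrite big_seq; apply: sumr_ge0 => z zF; rewrite mulr_ge0 ?ch0// ltW// (wg_weight_gt0 hG).
apply/negP => /eqP/esym; rewrite big_seq => /eqP; rewrite psumr_eq0; last first.
  by move=> z zF; rewrite mulr_ge0 ?ch0// ltW// (wg_weight_gt0 hG).
move=> /allP h; have := on1 _ y0F.
rewrite big_seq; under eq_bigr => y yF do rewrite hit_repr -?inF//.
rewrite -big_seq exchange_big /= big_seq big1 => [/esym/eqP|z zF]; first by rewrite oner_eq0.
rewrite -mulr_sumr; have /implyP/(_ zF) := h _ zF.
by rewrite mulf_eq0 gt_eqF ?(wg_weight_gt0 hG)//= => /eqP ->; rewrite mulr0.
Qed.

(** By reversibility [g(x,z) = pi(z) g(z,x) / pi(x)]. The common factor [g(y0,x) / pi(x)] cancels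
    between numerator and denominator, leaving finite sums of ratios that tend to 1. *)
Lemma hit_ratio_cvg y0 y : connected_graph a -> A y0 -> A y ->
  (forall z, green a setT z x / green a setT y0 x @[x --> far_from a A] --> (1 : R)) ->
  green a (~` A) x y / \sum_(w <- F) green a (~` A) x w @[x --> far_from a A] -->
  (\sum_(z <- F) vweight a z * charge_at y z) /
  (\sum_(z <- F) vweight a z * \sum_(w <- F) charge_at w z).
Proof.
move=> hconn Ay0 Ay hr.
have Ds := charge_total_gt0 (ex_intro _ y0 Ay0).
pose g z x := green a setT z x / green a setT y0 x.
have E x f : (\sum_(z <- F) green a setT x z * f z) =
   green a setT y0 x / vweight a x * \sum_(z <- F) vweight a z * (g z x * f z).
  rewrite mulr_sumr; apply: eq_bigr => z _.
  have := green_sym hG (in_setT x) (in_setT z) (hT x z) (hT z x).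
  have := wg_weight_gt0 hG x; have := green_gt0 hG hconn hT y0 x => g0 x0 e.
  have -> : green a setT x z = vweight a z * green a setT z x / vweight a x.
    by rewrite -e mulrAC divff ?mul1r// gt_eqF.
  rewrite /g; field; apply/andP; split; rewrite gt_eqF//.
have lim f : (\sum_(z <- F) vweight a z * (g z x * f z)) @[x --> far_from a A] -->
   \sum_(z <- F) vweight a z * f z.
  apply: cvg_big => [|z _]; first exact: add_continuous.
  apply: cvgM; first exact: cvg_cst.
  rewrite -[X in _ --> X]mul1r; apply: cvgM; [exact: hr|exact: cvg_cst].
have -> : (fun x => green a (~` A) x y / \sum_(w <- F) green a (~` A) x w) =
  (fun x => (\sum_(z <- F) vweight a z * (g z x * charge_at y z)) /
    (\sum_(z <- F) vweight a z * (g z x * \sum_(w <- F) charge_at w z))).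
  apply/funext => x.
  have -> : \sum_(w <- F) green a (~` A) x w =
      \sum_(z <- F) green a setT x z * \sum_(w <- F) charge_at w z.
    rewrite big_seq; under eq_bigr => w wF do rewrite hit_repr -?inF//.
    rewrite -big_seq exchange_big; apply: eq_bigr => z _; exact/esym/mulr_sumr.
  rewrite hit_repr ?inE// !E -mulf_div divff ?mul1r// mulf_neq0//.
    by rewrite gt_eqF// green_gt0.
  by rewrite invr_eq0 gt_eqF// (wg_weight_gt0 hG).
apply: cvgM; first exact: lim.
by apply: cvgV; [rewrite gt_eqF|exact: lim].
Qed.

End Hitting.

(** * The law of the random walk *)

Lemma far_notin (R : realType) (G : countType) (a : G -> G -> R) (A : set G) :
  \forall x \near far_from a A, ~ A x.
Proof.
exists 0 => // x /= h Ax; move: h; rewrite ltNge => /negP; apply.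
apply: (@le_trans _ _ (gdist a x x)); first by apply: ereal_inf_lbound; exists x.
by apply: ereal_inf_lbound; exists 0%N => //; exact: walk0.
Qed.

Section WalkLaw.
Context {R : realType} {G : countType} (a : G -> G -> R).
Context (d : measure_display) (Omega : measurableType d).
Context (X : nat -> Omega -> G) (P : G -> probability Omega R).
Hypotheses (hG : weighted_graph a) (hX : random_walk a X P).

(** Countable additivity over the values of [Y], indexed by their codes; codes that are not attained
    give empty fibres. *)
Lemma measure_fiber_sum (mu : {measure set Omega -> \bar R}) (T : countType)
    (Y : Omega -> T) (E : set Omega) :
  measurable E -> (forall t, measurable (Y @^-1` [set t])) ->
  mu E = (\sum_(0 <= i <oo) mu (E `&` [set w | choice.pickle (Y w) = i]))%E.
Proof.
move=> mE mY.
have mYi i : measurable [set w | choice.pickle (Y w) = i].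
  have [[w0 <-]|no] := pselect (exists w0, choice.pickle (Y w0) = i).
    rewrite (_ : [set w | _] = Y @^-1` [set Y w0])//.
    by apply/seteqP; split => w /=; [apply: (pcan_inj choice.pickleK)|move=> ->].
  rewrite (_ : [set w | _] = set0)//.
  by apply/seteqP; split => // w wi; apply: no; exists w.
rewrite -measure_semi_bigcup.
- congr (mu _); apply/seteqP; split => [w Ew|w [i _ []]//].
  by exists (choice.pickle (Y w)).
- by move=> i; exact: measurableI.
- by move=> i j _ _ [w [[_ <-] [_ <-]]].
- by apply: bigcup_measurable => i _; exact: measurableI.
Qed.

Lemma measurable_all_before B n :
  measurable [set w | forall k, (k < n)%N -> B (X k w)].
Proof.
rewrite (_ : [set w | _] = \bigcap_k if (k < n)%N then X k @^-1` B else setT).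
  by apply: bigcapT_measurable => k; case: ifP => // _; exact: (rw_measurable hX).
apply/seteqP; split => w /= h k.
  by move=> _; case: ifP => // /h.
by move=> kn; have := h k Logic.I; rewrite kn.
Qed.

Definition stay (B : set G) (n : nat) (x z : G) : set Omega :=
  [set w | [/\ X 0%N w = x, forall k, (k < n)%N -> B (X k w) & X n w = z]].

Lemma measurable_stay B n x z : measurable (stay B n x z).
Proof.
rewrite (_ : stay B n x z = X 0%N @^-1` [set x] `&`
    ([set w | forall k, (k < n)%N -> B (X k w)] `&` X n @^-1` [set z])).
  apply: measurableI; first exact: (rw_measurable hX).
  by apply: measurableI; [exact: measurable_all_before|exact: (rw_measurable hX)].
by apply/seteqP; split => w; [case=> ? ? ?|case=> ? []].
Qed.

(** The Markov property is given for one fully specified past; [stay] is cut into such pasts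
    according to the prefix [X_0, ..., X_n]. *)
Lemma stay_step B n x z y :
  P x (stay B n x z `&` X n.+1 @^-1` [set y]) =
  (P x (stay B n x z) * (trans a z y)%:E)%E.
Proof.
pose Y w := mkseq (fun k => X k w) n.+1.
have mY s : measurable (Y @^-1` [set s]).
  have [[w0 <-]|no] := pselect (exists w0, Y w0 = s); last first.
    rewrite (_ : _ @^-1` _ = set0)//.
    by apply/seteqP; split => // w ws; apply: no; exists w.
  rewrite (_ : _ @^-1` _ =
      \bigcap_k if (k < n.+1)%N then X k @^-1` [set X k w0] else setT).
    by apply: bigcapT_measurable => k; case: ifP => // _; exact: (rw_measurable hX).
  apply/seteqP; split => w /=.
    move=> e k _; case: ifP => // kn /=.
    by have := congr1 (fun s => nth (X k w) s k) e; rewrite !nth_mkseq.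
  move=> h; apply/eq_in_map => k; rewrite mem_iota add0n => /= kn.
  by have := h k Logic.I; rewrite kn.
have ms := measurable_stay B n x z.
rewrite (measure_fiber_sum _ (T := seq G) (Y := Y))//; last first.
  by apply: measurableI => //; exact: (rw_measurable hX).
rewrite [X in (X * _)%E](measure_fiber_sum _ (T := seq G) (Y := Y))//.
rewrite muleC -nneseriesZl//; apply: eq_eseriesr => i _; rewrite muleC.
have [[w0 [[w00 w0B w0n] w0i]]|no] :=
    pselect (exists w0, stay B n x z w0 /\ choice.pickle (Y w0) = i); last first.
  have none : stay B n x z `&` [set w | choice.pickle (Y w) = i] = set0.
    by apply/seteqP; split => // w [sw wi]; apply: no; exists w.
  by rewrite setIAC none set0I !measure0 mul0e.
have past : stay B n x z `&` [set w | choice.pickle (Y w) = i] =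
    [set w | forall k, (k <= n)%N -> X k w = X k w0].
  apply/seteqP; split => w /=.
    move=> [_]; rewrite -w0i => /(pcan_inj choice.pickleK) e k kn.
    by have := congr1 (fun s => nth (X k w) s k) e; rewrite !nth_mkseq.
  move=> h; split; first split; rewrite ?h//.
    by move=> k kn; rewrite (h k (ltnW kn)); exact: w0B.
  rewrite -w0i; congr (choice.pickle _); apply/eq_in_map => k.
  by rewrite mem_iota add0n => /= kn; rewrite h.
by rewrite setIAC past -w0n -(rw_markov hX).
Qed.

(** [stay] contains the condition [X_0 = x], which [first_hit] lacks; it holds almost surely under
    [P x]. *)
Lemma start_setI x E : measurable E -> P x (E `&` X 0%N @^-1` [set x]) = P x E.
Proof.
move=> mE; have m0 : measurable (X 0%N @^-1` [set x]) by exact: (rw_measurable hX).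
set S := X 0%N @^-1` [set x]; have PS : P x (~` S) = 0%E.
  by rewrite probability_setC// (rw_start hX) subee.
have PD : P x (E `\` S) = 0%E.
  apply/eqP; rewrite -measure_le0 -PS.
  apply: le_measure; rewrite ?inE; first exact: measurableD.
    exact: measurableC.
  by move=> w [].
have -> : P x E = (P x (E `\` S) + P x (E `&` S))%E by exact: measureDI.
by rewrite PD add0e.
Qed.

(** Induction on the last step, splitting by the position at time [n] and comparing with
    [killed_last]. *)
Lemma prob_stay B n x z : P x (stay B n x z) = (killed a B n x z)%:E.
Proof.
elim: n z => [|n IH] z.
  have m0 : measurable (X 0%N @^-1` [set x]) by exact: (rw_measurable hX).
  rewrite /=; case: eqP => [<-|xz].
    rewrite (_ : stay B 0 x x = X 0%N @^-1` [set x]) ?(rw_start hX)//.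
    by apply/seteqP; split => w [].
  rewrite (_ : stay B 0 x z = set0) ?measure0//.
  by apply/seteqP; split => // w [w0 _ wz]; case: xz; rewrite -w0 -wz.
have split_at v : stay B n.+1 x z `&` X n @^-1` [set v] =
    if v \in B then stay B n x v `&` X n.+1 @^-1` [set z] else set0.
  apply/seteqP; split => w.
    move=> [[w0 wB wz] wv]; rewrite -wv mem_set; last exact: wB.
    by split => //; split => // k kn; apply: wB; exact: ltnW.
  case: ifP => // vB [[w0 wB wv] wz]; split => //; split => // k.
  rewrite ltnS leq_eqVlt => /orP[/eqP ->|]; last exact: wB.
  by rewrite wv; exact: set_mem.
have prob_at v : P x (stay B n.+1 x z `&` X n @^-1` [set v]) =
    (killed a B n x v * ((v \in B)%:R * trans a v z))%:E.
  rewrite split_at; case: ifP => _; last by rewrite measure0 mul0r mulr0.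
  by rewrite stay_step IH mul1r EFinM.
have ms := measurable_stay B n.+1 x z.
pose N := X n @^-1` [set` nbrs a z].
have mN : measurable N by exact: (rw_measurable hX).
have -> : P x (stay B n.+1 x z) =
    (P x (stay B n.+1 x z `\` N) + P x (stay B n.+1 x z `&` N))%E.
  exact: measureDI.
(* A jump to [z] from a vertex not adjacent to it is null, and there are countably many such
   vertices. *)
have -> : P x (stay B n.+1 x z `\` N) = 0%E.
  rewrite (measure_fiber_sum _ (T := G) (Y := X n)); last 2 first.
  - exact: measurableD.
  - by move=> t; exact: (rw_measurable hX).
  apply: eseries0 => i _ _.
  have [[w0 [w0N w0i]]|no] := pselect (exists w0, ~ N w0 /\ choice.pickle (X n w0) = i).
    apply/eqP; rewrite -measure_le0.
    have <- : P x (stay B n.+1 x z `&` X n @^-1` [set X n w0]) = 0%E.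
      rewrite prob_at /trans (wg_sym hG) (not_adj_weight hG) ?mul0r ?mulr0//.
      exact/negP.
    apply: le_measure; rewrite ?inE.
    - apply: measurableI; first exact: measurableD.
      rewrite (_ : [set w | _] = X n @^-1` [set X n w0]).
        exact: (rw_measurable hX).
      by apply/seteqP; split => w /=; rewrite -w0i; [apply: (pcan_inj choice.pickleK)|move=> ->].
    - by apply: measurableI => //; exact: (rw_measurable hX).
    - move=> w [[sw _]] /=; rewrite -w0i => /(pcan_inj choice.pickleK) e.
      by split.
  rewrite (_ : _ `&` _ = set0) ?measure0//.
  by apply/seteqP; split => // w [[_ wN] wi]; apply: no; exists w.
rewrite add0e (_ : _ `&` N = \bigcup_(v in [set` nbrs a z])
    (stay B n.+1 x z `&` X n @^-1` [set v])); last first.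
  apply/seteqP; split => [w [sw wN]|w [v vz [sw wv]]]; first by exists (X n w).
  by split => //; rewrite /N /= wv.
rewrite measure_fin_bigcup//; last 2 first.
- by move=> u v _ _ [w [[_ <-] [_ <-]]].
- by move=> v _; apply: measurableI => //; exact: (rw_measurable hX).
rewrite fsbig_finite// set_fsetK.
rewrite (eq_bigr (fun v => (killed a B n x v * ((v \in B)%:R * trans a v z))%:E)).
  by rewrite sumEFin -(killed_last hG).
by move=> v _; exact: prob_at.
Qed.

(** The exit time is at least the number of [k < n] such that the walk is in the ball at all times
    up to [k]; then take expectations. *)
Lemma exit_time_ge_sum x r n (F : {fset G}) : [set` F] `<=` gball a x r ->
  ((\sum_(z <- F) green_part a (gball a x r) n x z)%:E
    <= mean_exit_time a X P x r)%E.
Proof.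
move=> FB; set B := gball a x r.
pose S k := [set w | forall j, (j < k.+1)%N -> B (X j w)].
have mS k : measurable (S k) by exact: measurable_all_before.
(* [stay] constrains the times below [k]; its end point in [F], hence in [B], settles time [k]. *)
have stayS k : (\sum_(z <- F) (killed a B k x z)%:E <= P x (S k))%E.
  under eq_bigr do rewrite -prob_stay.
  rewrite -measure_fbigsetU.
  - apply: le_measure; rewrite ?inE//.
      by apply: bigsetU_measurable => z _; exact: measurable_stay.
    rewrite -bigcup_seq => w [z zF [_ wB wz]] j.
    rewrite ltnS leq_eqVlt => /orP[/eqP ->|]; last exact: wB.
    by rewrite wz; exact: FB.
  - by move=> z _; exact: measurable_stay.
  - by move=> z z' _ _ [w [[_ _ <-] [_ _ <-]]].
have exit_ge w : (\sum_(k < n) (\1_(S k) w)%:E <= exit_time a X x r w :> \bar R)%E.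
  apply: le_ereal_inf_tmp => _ [m wm <-]; rewrite sumEFin lee_fin.
  (* A walk outside [B] at time [m] fails [S k] for every [k >= m]; the minimum with [n] carries the
     induction. *)
  suff : \sum_(k < n) \1_(S k) w <= (minn n m)%:R :> R.
    by move/le_trans; apply; rewrite ler_nat geq_minr.
  elim: n => [|k IH]; first by rewrite big_ord0.
  rewrite big_ord_recr /=; have [mk|km] := leqP m k.
    rewrite indicE memNset; last by move=> /(_ m); rewrite ltnS => /(_ mk).
    rewrite addr0; apply: le_trans IH _; rewrite ler_nat; lia.
  have -> : minn k.+1 m = (minn k m + 1)%N by lia.
  by rewrite natrD lerD// indicE; case: (_ \in _); rewrite ?ler01.
(* The exit time is at least [t] exactly when [X_k] is in [B] for every [k < t]. *)
have mE : measurable_fun setT (exit_time a X x r : Omega -> \bar R).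
  apply: (measurability _ (ErealGenCInfty.measurableE R)) => //.
  move=> _ [_ [t ->] <-]; rewrite setTI.
  rewrite (_ : _ @^-1` _ = \bigcap_k if t <= k%:R then setT else X k @^-1` B).
    by apply: bigcapT_measurable => k; case: ifP => // _; exact: (rw_measurable hX).
  apply/seteqP; split => w /=; rewrite in_itv/= andbT.
    move=> h k _; case: ifP => // /negP tk; apply: contrapT => wk; apply: tk.
    by rewrite -lee_fin; apply: le_trans h _; apply: ereal_inf_lbound; exists k.
  move=> h; apply: le_ereal_inf_tmp => _ [k wk <-]; rewrite lee_fin.
  by have := h k Logic.I; case: ifP.
apply: (@le_trans _ _ (\sum_(k < n) P x (S k))%E).
  rewrite -sumEFin /green_part; under eq_bigr do rewrite -sumEFin.
  by rewrite exchange_big /=; apply: lee_sum => k _; exact: stayS.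
under eq_bigr => k _ do rewrite -[S k]setIT -integral_indic//.
rewrite -ge0_integral_sum//; last first.
  by move=> k; apply/measurable_EFinP; exact: measurable_indic.
apply: ge0_le_integral => //.
- by move=> w _; apply: sume_ge0 => k _.
- by apply: emeasurable_sum => k; apply/measurable_EFinP; exact: measurable_indic.
Qed.

(** * First hits of [A] and the hitting distribution *)

Context (A : set G).

Definition first_hit (n : nat) (y : G) : set Omega :=
  [set w | [/\ (1 <= n)%N, forall k, (1 <= k < n)%N -> ~ A (X k w) & X n w = y]].

Lemma measurable_first_hit n y : measurable (first_hit n y).
Proof.
rewrite (_ : first_hit n y =
    (\bigcap_k if (1 <= k < n)%N then X k @^-1` (~` A) else setT) `&`
    (if (1 <= n)%N then X n @^-1` [set y] else set0)).
  apply: measurableI; last by case: ifP => // _; exact: (rw_measurable hX).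
  by apply: bigcapT_measurable => k; case: ifP => // _; exact: (rw_measurable hX).
apply/seteqP; split => w /=.
  by case=> -> h wy; split => // k _; case: ifP => // /h.
case=> h; case: ifP => // n1 wy; split => // k kn.
by have := h k Logic.I; rewrite kn.
Qed.

Lemma first_hitP n y w : A y -> first_hit n y w ->
  hitting_time R X A w = (n%:R)%:E.
Proof.
move=> Ay [n1 h wy]; apply/eqP; rewrite eq_le; apply/andP; split.
  by apply: ereal_inf_lbound; exists n => //; split => //; rewrite wy.
apply: le_ereal_inf_tmp => _ [k [k1 wk] <-]; rewrite lee_fin ler_nat leqNgt.
by apply/negP => kn; apply: (h k); rewrite ?k1.
Qed.

Lemma hits_first_hit w : hits R X A w -> exists n, first_hit n (X n w) w /\ A (X n w).
Proof.
move=> /ereal_inf_lt[_ [k wk _] _].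
have ex : exists k, `[< (1 <= k)%N /\ A (X k w) >] by exists k; exact/asboolP.
have [m /asboolP[m1 wm] mmin] := ex_minnP ex.
exists m; split => //; split => // j /andP[j1 jm] wj.
have /(leq_trans jm) := mmin j (introT (asboolP _) (conj j1 wj)).
by rewrite ltnn.
Qed.

Lemma hits_at_bigcup y : A y -> hits_at R X A y = \bigcup_n first_hit n y.
Proof.
move=> Ay; apply/seteqP; split => w.
  move=> [k hk wk]; have [|n [hn An]] := @hits_first_hit w.
    by rewrite /hits/= hk ltry.
  exists n => //; suff nk : n = k by rewrite -wk -nk.
  move: hk; rewrite (first_hitP An hn) => -[] /eqP.
  by rewrite eqr_nat => /eqP.
move=> [n _ hn]; exists n; first exact: first_hitP hn.
by case: hn.
Qed.

Lemma measurable_hits_at y : A y -> measurable (hits_at R X A y).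
Proof.
by move=> /hits_at_bigcup ->; apply: bigcup_measurable => n _; exact: measurable_first_hit.
Qed.

Hypothesis hT : forall x z, green_bounded a setT x z.

(** From a start outside [A], avoiding [A] at the times [1, ..., n-1] is the same as staying in its
    complement at the times [0, ..., n-1], so the first hit at time [n] has probability [killed]. *)
Lemma prob_hits_at x y : ~ A x -> A y ->
  P x (hits_at R X A y) = (green a (~` A) x y)%:E.
Proof.
move=> Ax Ay; rewrite hits_at_bigcup// measure_semi_bigcup; last 3 first.
- by move=> n; exact: measurable_first_hit.
- move=> m n _ _ [w [/(first_hitP Ay) hm /(first_hitP Ay)]].
  by rewrite hm => -[] /eqP; rewrite eqr_nat => /eqP.
- by apply: bigcup_measurable => n _; exact: measurable_first_hit.
have E n : P x (first_hit n y) = (killed a (~` A) n x y)%:E.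
  rewrite -prob_stay -start_setI; last exact: measurable_first_hit.
  congr (P x _); apply/seteqP; split => w /=.
    move=> [[n1 h wy] w0]; split => // -[_|k kn]; first by rewrite w0.
    exact: h.
  move=> [w0 h wy]; split => //; split => //.
    (* At [n = 0] the start [x] would equal [y], which lies in [A]. *)
    by case: n wy {h} => // wy; case: Ax; rewrite -w0 wy.
  by move=> k /andP[_ kn]; exact: h.
rewrite (eq_eseriesr (g := fun n => (killed a (~` A) n x y)%:E)); last first.
  by move=> n _; exact: E.
rewrite -EFin_lim; last first.
  by apply: cvgP; apply: (green_part_cvg hG); exact: green_bounded_sub.
congr (limn _); apply/funext => n /=.
by rewrite sumEFin big_mkord.
Qed.

Hypothesis hA : finite_set A.

Lemma prob_hits x : ~ A x ->
  P x (hits R X A) = (\sum_(y <- fset_set A) green a (~` A) x y)%:E.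
Proof.
move=> Ax; have -> : hits R X A = \bigcup_(y in A) hits_at R X A y.
  apply/seteqP; split => w.
    move=> /hits_first_hit[n [hn An]]; exists (X n w) => //.
    by rewrite hits_at_bigcup//; exists n.
  by move=> [y Ay [k hk _]]; rewrite /hits/= hk ltry.
rewrite measure_fin_bigcup//; last 2 first.
- move=> y z _ _ [w [[k hk <-] [l hl <-]]]; move: hl; rewrite hk => -[] /eqP.
  by rewrite eqr_nat => /eqP ->.
- by move=> y Ay; exact: measurable_hits_at.
rewrite fsbig_finite// -sumEFin !big_seq; apply: eq_bigr => y.
by rewrite in_fset_set// inE => Ay; exact: prob_hits_at.
Qed.

Lemma hitting_distributionE x y : ~ A x -> A y ->
  hitting_distribution X P A x y =
  green a (~` A) x y / \sum_(w <- fset_set A) green a (~` A) x w.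
Proof.
move=> Ax Ay; rewrite /hitting_distribution /cond_prob prob_hits//.
rewrite (setIidl (A := hits_at R X A y)) ?prob_hits_at//.
by move=> w [k hk _]; rewrite /hits/= hk ltry.
Qed.

End WalkLaw.

Theorem corollary1p5 (R : realType) (G : countType) (a : G -> G -> R)
    (d : measure_display) (Omega : measurableType d)
    (X : nat -> Omega -> G) (P : G -> probability Omega R)
    (alpha beta M C : R)
    (hG : weighted_graph a) (hconn : connected_graph a)
    (hX : random_walk a X P)
    (hbeta : 2 <= beta) (halpha : beta < alpha)
    (hV : volume_growth a alpha) (hE : exit_time_growth a X P beta)
    (hM : 1 < M) (hH : elliptic_harnack a M C)
    (A : set G) (hA : finite_set A) (y : G) (hy : A y) :
  exists l : R, hitting_distribution X P A x y @[x --> far_from a A] --> l.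
Proof.
have hT : forall x z, green_bounded a setT x z.
  apply: (green_bounded_full hG hconn halpha hV hM hH).
  have [c c1 hc] := hE; exists c; first exact: lt_le_trans c1.
  move=> x r r1 F FB n; have /andP[_ h] := hc x r r1.
  by rewrite -lee_fin; apply: le_trans h; exact: exit_time_ge_sum.
(* The point [y] itself serves as the reference point [y0]. *)
eexists; apply: cvg_trans (hit_ratio_cvg hG hA hT hconn hy hy _); last first.
  by move=> z; exact: (green_ratio_far hG hconn hV hM hH hT).
(* The formula for the hitting distribution requires [x] outside [A], which holds eventually. *)
apply: near_eq_cvg; near=> x; apply/esym/(hitting_distributionE hG hX) => //.
by near: x; exact: far_notin.
Unshelve. all: by end_near. Qed.
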